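(* Let $(M^{2n+1},\phi,\xi,\eta,g,\nabla,\nabla^{*})$ be an almost cosymplectic statistical manifold, and let $\mathcal{A}X=-\nabla_{X}\xi$, $\mathcal{A}^{*}X=-\nabla^{*}_{X}\xi$. Then, for all vector fields $X,Y$ on $M$, $$4R^{0}(X,Y)\xi=R(X,Y)\xi+R^{*}(X,Y)\xi+(\nabla^{*}_{Y}\mathcal{A})X-(\nabla^{*}_{X}\mathcal{A})Y+(\nabla_{Y}\mathcal{A}^{*})X-(\nabla_{X}\mathcal{A}^{*})Y.$$
   Context: A statistical manifold $(M,g,\nabla,\nabla^{*})$ is a Riemannian manifold $(M,g)$ with torsion-free affine connections $\nabla,\nabla^{*}$ satisfying $Zg(X,Y)=g(\nabla_{Z}X,Y)+g(X,\nabla^{*}_{Z}Y)$ for all vector fields $X,Y,Z$. An almost contact metric manifold $(M^{2n+1},\phi,\xi,\eta,g)$ has a $(1,1)$-tensor field $\phi$, a vector field $\xi$, a 1-form $\eta$ and a Riemannian metric $g$ with $\phi^{2}=-\mathrm{Id}+\eta\otimes\xi$, $\eta(\xi)=1$, $g(\phi X,\phi Y)=g(X,Y)-\eta(X)\eta(Y)$. Its fundamental form is $\Phi(X,Y)=g(\phi X,Y)$. It is almost cosymplectic if $d\eta=0$ and $d\Phi=0$. An almost cosymplectic statistical manifold is a statistical manifold $(M,g,\nabla,\nabla^{*})$ together with an almost cosymplectic structure $(\phi,\xi,\eta,g)$ with the same metric $g$. $R$, $R^{*}$, $R^{0}$ are the curvature tensors of $\nabla$, $\nabla^{*}$ and the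 Levi-Civita connection $\nabla^{0}$ of $g$, with the convention $R(X,Y)Z=\nabla_{X}\nabla_{Y}Z-\nabla_{Y}\nabla_{X}Z-\nabla_{[X,Y]}Z$. *)

(* Defs.v *)
From HB Require Import structures.
From mathcomp Require Import all_boot all_order all_algebra.
From mathcomp Require Import all_classical all_reals all_analysis.

Set Implicit Arguments.
Unset Strict Implicit.
Unset Printing Implicit Defensive.

Import Order.TTheory GRing.Theory Num.Theory.
Import numFieldNormedType.Exports.

Local Open Scope classical_set_scope.
Local Open Scope ring_scope.

Section SmoothOn.
Context {R : realType} {m : nat}.
Implicit Types (U : set 'rV[R]_m) (f g : 'rV[R]_m -> R).

Fixpoint Ck_on (k : nat) U f : Prop :=
  {in U, continuous f} /\
  if k is k'.+1 then
    forall i : 'I_m, {in U, forall x, derivable f x (delta_mx 0 i)} /\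
                     Ck_on k' U ('D_(delta_mx 0 i) f)
  else True.

Definition smooth_on U f := forall k, Ck_on k U f.

Lemma near_eq_on U f g x : open U -> {in U, f =1 g} -> x \in U ->
  \forall y \near x, f y = g y.
Proof.
move=> oU fg /set_mem Ux; have : nbhs x U by exact: open_nbhs_nbhs.
by apply: filterS => y Uy; apply: fg; rewrite inE.
Qed.

Lemma eq_cont_on U f g : open U -> {in U, f =1 g} ->
  {in U, continuous f} -> {in U, continuous g}.
Proof.
move=> oU fg fc x Ux; rewrite /continuous_at -(fg x Ux).
exact: cvg_trans (near_eq_cvg (near_eq_on oU fg Ux)) (fc x Ux).
Qed.

Lemma eq_Ck_on k U f g : open U -> {in U, f =1 g} -> Ck_on k U f -> Ck_on k U g.
Proof.
move=> oU; elim: k f g => [|k IH] f g fg [fc H]; split => //.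
- exact: eq_cont_on fc.
- exact: eq_cont_on fc.
- move=> i; have [df Cf] := H i; split=> [x Ux|].
    by apply: near_eq_derivable (df x Ux); exact: (near_eq_on oU fg Ux).
  apply: IH Cf => x Ux; apply: near_eq_derive.
  exact: (near_eq_on oU fg Ux).
Qed.

Lemma Ck_onW k U f : Ck_on k.+1 U f -> Ck_on k U f.
Proof.
elim: k f => [|k IH] f [fc H]; split=> // i; have [df Cf] := H i.
by split=> //; exact: IH.
Qed.

Lemma Ck_on_cst k U (c : R) : Ck_on k U (cst c).
Proof.
elim: k c => [|k IH] c; split=> //; try by move=> x _; exact: cst_continuous.
move=> i; split=> [x _|]; first exact: derivable_cst.
rewrite (_ : 'D_ _ (cst c) = cst 0); first exact: IH.
by apply/funext => x; rewrite derive_cst.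
Qed.

Lemma Ck_onD k U f g : open U ->
  Ck_on k U f -> Ck_on k U g -> Ck_on k U (f + g).
Proof.
move=> oU; elim: k f g => [|k IH] f g [fc Hf] [gc Hg]; split=> //.
- by move=> x Ux; exact: cvgD (fc x Ux) (gc x Ux).
- by move=> x Ux; exact: cvgD (fc x Ux) (gc x Ux).
- move=> i; have [df Cf] := Hf i; have [dg Cg] := Hg i; split=> [x Ux|].
    by apply: derivableD; [exact: df|exact: dg].
  apply: eq_Ck_on (IH _ _ Cf Cg) => // x Ux.
  by rewrite deriveD//; [exact: df|exact: dg].
Qed.

Lemma Ck_onM k U f g : open U ->
  Ck_on k U f -> Ck_on k U g -> Ck_on k U (f * g).
Proof.
move=> oU; elim: k f g => [|k IH] f g; move=> Kf Kg; have [fc Hf] := Kf;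
  have [gc Hg] := Kg; split=> //.
- by move=> x Ux; exact: cvgM (fc x Ux) (gc x Ux).
- by move=> x Ux; exact: cvgM (fc x Ux) (gc x Ux).
- move=> i; have [df Cf] := Hf i; have [dg Cg] := Hg i; split=> [x Ux|].
    by apply: derivableM; [exact: df|exact: dg].
  have := Ck_onD oU (IH _ _ (Ck_onW Kf) Cg) (IH _ _ (Ck_onW Kg) Cf).
  apply: eq_Ck_on => // x Ux.
  by rewrite deriveM//; [exact: df|exact: dg].
Qed.

End SmoothOn.

(* [chart_inv] is only meaningful on [chart_img], [chart_map] on [chart_dom]. *)
Record chart (R : realType) (m : nat) (T : topologicalType) := Chart {
  chart_dom : set T;
  chart_img : set 'rV[R]_m;
  chart_map : T -> 'rV[R]_m;
  chart_inv : 'rV[R]_m -> T;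
  chart_dom_open : open chart_dom;
  chart_img_open : open chart_img;
  chart_map_img : forall p, chart_dom p -> chart_img (chart_map p);
  chart_inv_dom : forall x, chart_img x -> chart_dom (chart_inv x);
  chart_mapK : {in chart_dom, cancel chart_map chart_inv};
  chart_invK : {in chart_img, cancel chart_inv chart_map};
  chart_map_continuous : {in chart_dom, continuous chart_map};
  chart_inv_continuous : {in chart_img, continuous chart_inv}
}.

Record smoothManifold (R : realType) (m : nat) := SmoothManifold {
  carrier :> topologicalType;
  manifold_hausdorff : hausdorff_space carrier;
  manifold_second_countable : @second_countable carrier;
  atlas : set (chart R m carrier);
  atlas_cover : \bigcup_(c in atlas) chart_dom c = setT;
  atlas_compat : forall c d, atlas c -> atlas d -> forall j : 'I_m,
    smooth_on [set x | chart_img c x /\ chart_dom d (chart_inv c x)]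
              (fun x => chart_map d (chart_inv c x) 0 j)
}.

Section SmoothFunctions.
Context {R : realType} {m : nat}.
Implicit Type M : smoothManifold R m.

(* The atlas need not be maximal: enlarging it by compatible charts does not
   change the smooth functions. *)
Definition smooth_pred M : {pred M -> R} := fun f =>
  `[< forall c, atlas c -> smooth_on (chart_img c) (f \o chart_inv c) >].

Record smooth_fun M := SmoothFun {
  smooth_val :> M -> R;
  smooth_valP : smooth_val \in @smooth_pred M
}.

Lemma smooth_subring_closed M : subring_closed (@smooth_pred M).
Proof.
have oI := @chart_img_open R m M.
have cstP a : cst a \in @smooth_pred M.
  by apply/asboolP => c _ k; exact: Ck_on_cst.
have mulP f g : f \in @smooth_pred M -> g \in @smooth_pred M ->
    f * g \in @smooth_pred M.
  move=> /asboolP fS /asboolP gS; apply/asboolP => c cA k.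
  exact: (Ck_onM (oI c) (fS c cA k) (gS c cA k)).
split=> [|f g fS gS|//]; first exact: cstP.
have /asboolP gN := mulP _ _ (cstP (-1)) gS.
move/asboolP: fS => fS; apply/asboolP => c cA k.
apply: eq_Ck_on (Ck_onD (oI c) (fS c cA k) (gN c cA k)) => // x _ /=.
by rewrite /GRing.add/= /GRing.mul/= mulN1r.
Qed.

HB.instance Definition _ M := [isSub for @smooth_val M].
HB.instance Definition _ M := [Choice of smooth_fun M by <:].
HB.instance Definition _ M := GRing.SubChoice_isSubComPzRing.Build _ _
  (smooth_fun M) (@smooth_subring_closed M).

Lemma smooth_cst_subproof M (a : R) : cst a \in @smooth_pred M.
Proof. by apply/asboolP => c _ k; exact: Ck_on_cst. Qed.

Definition smooth_cst M (a : R) : smooth_fun M :=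
  SmoothFun (smooth_cst_subproof M a).

End SmoothFunctions.

Section VectorFields.
Context {R : realType} {m : nat}.
Variable M : smoothManifold R m.

Record derivation_axioms (X : smooth_fun M -> smooth_fun M) : Prop := {
  derivationD : forall f g, X (f + g) = X f + X g;
  derivationZ : forall a f, X (smooth_cst M a * f) = smooth_cst M a * X f;
  derivationM : forall f g, X (f * g) = f * X g + X f * g
}.

Definition derivation_pred : {pred smooth_fun M -> smooth_fun M} :=
  fun X => `[< derivation_axioms X >].

(* A vector field is a derivation of the algebra of smooth functions; its value
   at p is the tangent vector f |-> X f p (a derivation at p). *)
Record vector_field := VectorField {
  vf_val :> smooth_fun M -> smooth_fun M;
  vf_valP : vf_val \in derivation_pred
}.

Lemma derivation_zmod_closed : zmod_closed derivation_pred.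
Proof.
split=> [|X Y /asboolP[XD XZ XM] /asboolP[YD YZ YM]]; apply/asboolP.
  by split=> *; rewrite /GRing.zero/= ?(addr0, mulr0, mul0r).
have E f : (X - Y) f = X f - Y f by [].
split=> *; rewrite !E.
- by rewrite XD YD opprD addrACA.
- by rewrite XZ YZ mulrBr.
- by rewrite XM YM opprD addrACA mulrBr mulrBl.
Qed.

HB.instance Definition _ := [isSub for vf_val].
HB.instance Definition _ := [Choice of vector_field by <:].
HB.instance Definition _ :=
  GRing.isZmodClosed.Build _ derivation_pred derivation_zmod_closed.
HB.instance Definition _ := [SubChoice_isSubZmodule of vector_field by <:].

Lemma vf_scale_subproof (h : smooth_fun M) (X : vector_field) :
  (fun f => h * X f) \in derivation_pred.
Proof.
have /asboolP[XD XZ XM] := vf_valP X; apply/asboolP; split=> *.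
- by rewrite XD mulrDr.
- by rewrite XZ mulrCA.
- by rewrite XM mulrDr mulrCA -mulrA.
Qed.

Definition vf_scale h X := VectorField (vf_scale_subproof h X).

Let vf_scaleA h k X : vf_scale h (vf_scale k X) = vf_scale (h * k) X.
Proof. by apply/val_inj/funext => f /=; rewrite mulrA. Qed.
Let vf_scale1 : left_id 1 vf_scale.
Proof. by move=> X; apply/val_inj/funext => f /=; rewrite mul1r. Qed.
Let vf_scaleDr : right_distributive vf_scale +%R.
Proof. by move=> h X Y; apply/val_inj/funext => f; exact: mulrDr. Qed.
Let vf_scaleDl X : {morph vf_scale^~ X : h k / h + k}.
Proof. by move=> h k; apply/val_inj/funext => f; exact: mulrDl. Qed.

HB.instance Definition _ := GRing.Zmodule_isLmodule.Build (smooth_fun M)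
  vector_field vf_scaleA vf_scale1 vf_scaleDr vf_scaleDl.

Lemma lie_subproof (X Y : vector_field) :
  (fun f => X (Y f) - Y (X f)) \in derivation_pred.
Proof.
have /asboolP[XD XZ XM] := vf_valP X; have /asboolP[YD YZ YM] := vf_valP Y.
apply/asboolP; split=> *.
- by rewrite !(XD, YD) opprD addrACA.
- by rewrite !(XZ, YZ) mulrBr.
- rewrite !(XM, YM, XD, YD) mulrBr mulrBl.
  have addE (V : zmodType) (a b c d e h : V) :
      a + b + (c + d) - (e + c + (b + h)) = a - e + (d - h).
    rewrite (addrACA a) opprD (addrACA (a + c)) !opprD.
    by rewrite (addrACA a) subrr addr0 (addrACA b) subrr add0r.
  exact: addE.
Qed.

Definition lie_bracket X Y : vector_field := VectorField (lie_subproof X Y).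

End VectorFields.

Notation "[[ X , Y ]]" := (lie_bracket X Y)
  (at level 0, X, Y at level 99, format "[[ X ,  Y ]]") : ring_scope.

Section Geometry.
Context {R : realType} {m : nat} (M : smoothManifold R m).
Implicit Types (X Y Z : vector_field M) (f : smooth_fun M).

(* Tensor fields are given by their action on vector fields, as maps that are
   linear over the ring of smooth functions. *)
Record riemannian_metric := RiemannianMetric {
  riem_val :> vector_field M -> vector_field M -> smooth_fun M;
  riem_linear : forall Y, scalar (riem_val^~ Y);
  riem_sym : forall X Y, riem_val X Y = riem_val Y X;
  riem_pos : forall X (p : M), (exists f, X f p != 0) -> 0 < riem_val X X p
}.

Record affine_connection := AffineConnection {
  nabla :> vector_field M -> vector_field M -> vector_field M;
  nabla_linear : forall Y, linear (nabla^~ Y);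
  nablaD : forall X Y Z, nabla X (Y + Z) = nabla X Y + nabla X Z;
  nabla_leibniz : forall f X Y, nabla X (f *: Y) = X f *: Y + f *: nabla X Y
}.

Definition torsion_free (D : affine_connection) : Prop :=
  forall X Y, D X Y - D Y X = [[X, Y]].

Definition dual_connections (g : riemannian_metric) (D Ds : affine_connection) :
    Prop :=
  forall X Y Z, Z (g X Y) = g (D Z X) Y + g X (Ds Z Y).

Definition metric_compatible (g : riemannian_metric) (D : affine_connection) :
    Prop :=
  forall X Y Z, Z (g X Y) = g (D Z X) Y + g X (D Z Y).

Definition levi_civita (g : riemannian_metric) (D : affine_connection) : Prop :=
  torsion_free D /\ metric_compatible g D.

Definition statistical_structure (g : riemannian_metric)
    (D Ds : affine_connection) : Prop :=
  [/\ torsion_free D, torsion_free Ds & dual_connections g D Ds].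

Definition curvature (D : affine_connection) X Y Z : vector_field M :=
  D X (D Y Z) - D Y (D X Z) - D [[X, Y]] Z.

(* [cov_endo D A Y X] is (D_Y A) X for a (1,1)-tensor field A. *)
Definition cov_endo (D : affine_connection)
    (A : vector_field M -> vector_field M) Y X : vector_field M :=
  D Y (A X) - A (D Y X).

Definition shape_op (D : affine_connection) (xi : vector_field M) X :
    vector_field M := - D X xi.

Record almost_contact_metric (phi : {linear vector_field M -> vector_field M})
    (xi : vector_field M) (eta : {scalar vector_field M})
    (g : riemannian_metric) : Prop := AlmostContactMetric {
  phi_sqr : forall X, phi (phi X) = - X + eta X *: xi;
  eta_xi : eta xi = 1;
  metric_phi : forall X Y, g (phi X) (phi Y) = g X Y - eta X * eta Y
}.

Definition fundamental_form (phi : {linear vector_field M -> vector_field M})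
    (g : riemannian_metric) X Y : smooth_fun M := g (phi X) Y.

(* Exterior derivatives, up to the convention-dependent factors 1/2 and 1/3,
   which do not affect closedness. *)
Definition ext_deriv1 (w : vector_field M -> smooth_fun M) X Y : smooth_fun M :=
  X (w Y) - Y (w X) - w [[X, Y]].

Definition ext_deriv2 (w : vector_field M -> vector_field M -> smooth_fun M)
    X Y Z : smooth_fun M :=
  X (w Y Z) - Y (w X Z) + Z (w X Y)
  - w [[X, Y]] Z + w [[X, Z]] Y - w [[Y, Z]] X.

Record almost_cosymplectic (phi : {linear vector_field M -> vector_field M})
    (xi : vector_field M) (eta : {scalar vector_field M})
    (g : riemannian_metric) : Prop := AlmostCosymplectic {
  cosymplectic_contact : almost_contact_metric phi xi eta g;
  eta_closed : forall X Y, ext_deriv1 eta X Y = 0;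
  fundamental_closed :
    forall X Y Z, ext_deriv2 (fundamental_form phi g) X Y Z = 0
}.

Record almost_cosymplectic_statistical
    (phi : {linear vector_field M -> vector_field M})
    (xi : vector_field M) (eta : {scalar vector_field M})
    (g : riemannian_metric) (D Ds : affine_connection) : Prop :=
    AlmostCosymplecticStatistical {
  acs_cosymplectic : almost_cosymplectic phi xi eta g;
  acs_statistical : statistical_structure g D Ds
}.

End Geometry.

(* Main.v *)
Require Import Defs.
From HB Require Import structures.
From mathcomp Require Import all_boot all_order all_algebra.
From mathcomp Require Import all_classical all_reals all_analysis.
From mathcomp Require Import ring.

Import Order.TTheory GRing.Theory Num.Theory.
Import numFieldNormedType.Exports.

Local Open Scope ring_scope.

(** Averaging the dual connections of a statistical manifold gives a
    torsion-free metric connection, so [D + Ds = 2 D0] by uniqueness of the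
    Levi-Civita connection ([levi_civita_mean]). Uniqueness is the usual one:
    the difference tensor paired with the metric is symmetric in its first two
    arguments and skew in its last two, hence zero, and the metric is
    nondegenerate ([riem_nondegenerate]).

    Consequently [4 D0_X D0_Y xi = (D + Ds)_X (D + Ds)_Y xi]. Expanding
    [4 R0(X,Y) xi], the unmixed second derivatives make up [R + Rs], while the
    mixed ones are the second-derivative part of the covariant derivatives of
    the shape operators; the remaining first-order terms of the latter add up
    to [- (D + Ds)_[[X, Y]] xi] because both connections are torsion-free
    ([cov_endo_shape_op_alt]). *)

Section MetricAndConnections.
Context {R : realType} {m : nat} {M : smoothManifold R m}.
Implicit Types (g : riemannian_metric M) (D Ds : affine_connection M).
Implicit Types (X Y Z : vector_field M).

Lemma vfDE X Y (f : smooth_fun M) : (X + Y) f = X f + Y f.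
Proof. by []. Qed.

Lemma vfNE X (f : smooth_fun M) : (- X) f = - X f.
Proof. by []. Qed.

(** Evaluating at a function turns additive identities between vector fields
    into identities in a commutative ring. *)
Lemma vector_field_ext X Y : (forall f, X f = Y f) -> X = Y.
Proof. by move=> XY; apply/val_inj/funext. Qed.

Lemma smooth_fun_mulr2n_eq0 (f : smooth_fun M) : f *+ 2 = 0 -> f = 0.
Proof.
move=> f2; apply/val_inj/funext => p /=.
have := congr1 (fun h : smooth_fun M => h p) f2.
by move=> /eqP; rewrite /= -[_ p]/(f p + f p) -mulr2n mulrn_eq0 => /eqP.
Qed.

Lemma riemBl g X Y Z : g (X - Y) Z = g X Z - g Y Z.
Proof.
have := riem_linear g Z (-1) Y X.
by rewrite /= scaleN1r mulN1r (addrC (- Y)) (addrC (- g Y Z)).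
Qed.

Lemma riem0l g Z : g 0 Z = 0.
Proof. by rewrite -(subrr 0) riemBl subrr. Qed.

Lemma riemDl g X Y Z : g (X + Y) Z = g X Z + g Y Z.
Proof. by rewrite -{1}[Y]opprK riemBl -[- Y]add0r riemBl riem0l sub0r opprK. Qed.

Lemma riem_nondegenerate g X : (forall Y, g X Y = 0) -> X = 0.
Proof.
move=> gX; apply/val_inj/funext => f; apply/val_inj/funext => p /=.
apply/eqP/negPn/negP => Xfp.
by have := riem_pos g (ex_intro _ f Xfp); rewrite gX ltxx.
Qed.

(** The uniqueness argument for the Levi-Civita connection, for a map [T] that
    plays the role of the difference of two connections. *)
Lemma sym_skew_eq0 g (T : vector_field M -> vector_field M -> vector_field M) :
  (forall X Y, T X Y = T Y X) ->
  (forall X Y Z, g (T Z X) Y + g X (T Z Y) = 0) ->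
  forall X Y, T X Y = 0.
Proof.
move=> Tsym Tskew.
have skew X Y Z : g (T Z X) Y = - g (T Z Y) X.
  by apply/eqP; rewrite -addr_eq0 (riem_sym g (T Z Y)) Tskew.
move=> X Y; apply: (@riem_nondegenerate g) => Z.
apply: smooth_fun_mulr2n_eq0; rewrite mulr2n.
(* Three uses each of skewness and symmetry bring [g (T X Y) Z] back to its
   opposite. *)
rewrite {1}skew {1}(Tsym X Z) skew (Tsym Z Y) skew (Tsym Y X).
by rewrite !opprK addNr.
Qed.

Lemma nablaN D X Y : D X (- Y) = - D X Y.
Proof.
have D0 : D X 0 = 0 by apply/(addrI (D X 0)); rewrite -nablaD !addr0.
by apply/eqP; rewrite -addr_eq0 -nablaD addNr D0.
Qed.

Lemma nablaBl D X Y Z : D (X - Y) Z = D X Z - D Y Z.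
Proof.
have := nabla_linear D Z (-1) Y X.
by rewrite /= !scaleN1r (addrC (- Y)) (addrC (- D Y Z)).
Qed.

Lemma levi_civita_mean g D Ds (D0 : affine_connection M) :
  statistical_structure g D Ds -> levi_civita g D0 ->
  forall X Y, D X Y + Ds X Y = D0 X Y *+ 2.
Proof.
move=> [tD tDs dual] [tD0 compat] X Y; apply/eqP; rewrite -subr_eq0; apply/eqP.
move: X Y.
apply: (sym_skew_eq0 g (fun X Y => D X Y + Ds X Y - D0 X Y *+ 2)) => [X Y|X Y Z].
  have -> : D X Y = [[X, Y]] + D Y X by rewrite -tD subrK.
  have -> : Ds X Y = [[X, Y]] + Ds Y X by rewrite -tDs subrK.
  have -> : D0 X Y = [[X, Y]] + D0 Y X by rewrite -tD0 subrK.
  rewrite mulr2n; apply: vector_field_ext => f; rewrite !(vfDE, vfNE); ring.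
rewrite (riem_sym g X) !(riemBl, riemDl, mulr2n).
have dualXY := dual X Y Z; have dualYX := dual Y X Z.
have compatXY := compat X Y Z.
rewrite (riem_sym g X (Ds Z Y)) in dualXY.
rewrite (riem_sym g Y X) (riem_sym g Y (Ds Z X)) in dualYX.
rewrite (riem_sym g X (D0 Z Y)) in compatXY.
(* The two duality identities for [Z (g X Y)] minus twice the metric one. *)
transitivity (Z (g X Y) + Z (g X Y) - (Z (g X Y) + Z (g X Y)));
  last by rewrite subrr.
rewrite {1}dualXY {1}dualYX compatXY; ring.
Qed.

(** The bracket term comes from [D_(Ds_Y X - Ds_X Y) xi], as [Ds] is
    torsion-free. *)
Lemma cov_endo_shape_op_alt D Ds xi X Y : torsion_free Ds ->
  cov_endo Ds (shape_op D xi) Y X - cov_endo Ds (shape_op D xi) X Y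
  = Ds X (D Y xi) - Ds Y (D X xi) - D [[X, Y]] xi.
Proof.
move=> tDs; rewrite /cov_endo /shape_op !nablaN -tDs nablaBl.
apply: vector_field_ext => f; rewrite !(vfDE, vfNE); ring.
Qed.

(** The curvature of the mean connection: the last two terms are the mixed
    derivatives, each with its share of
    [4 D0_[[X, Y]] Z = 2 (D + Ds)_[[X, Y]] Z]. *)
Lemma curvature_mean D Ds (D0 : affine_connection M) :
  (forall X Y, D X Y + Ds X Y = D0 X Y *+ 2) ->
  forall X Y Z, curvature D0 X Y Z *+ 4
    = curvature D X Y Z + curvature Ds X Y Z
      + (Ds X (D Y Z) - Ds Y (D X Z) - D [[X, Y]] Z)
      + (D X (Ds Y Z) - D Y (Ds X Z) - Ds [[X, Y]] Z).
Proof.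
move=> mean X Y Z.
have mean2 U V : D0 U (D0 V Z) *+ 4
    = D U (D V Z) + D U (Ds V Z) + (Ds U (D V Z) + Ds U (Ds V Z)).
  by rewrite -!nablaD !mean (mulr2n (D0 V Z)) nablaD -mulr2n -mulrnA.
have mean4 : D0 [[X, Y]] Z *+ 4 = (D [[X, Y]] Z + Ds [[X, Y]] Z) *+ 2.
  by rewrite mean -mulrnA.
rewrite /curvature !mulrnBl !mean2 mean4 mulr2n.
apply: vector_field_ext => f; rewrite !(vfDE, vfNE); ring.
Qed.

End MetricAndConnections.

Theorem theorem8 (R : realType) (n : nat) (M : smoothManifold R (2 * n).+1)
    (phi : {linear vector_field M -> vector_field M}) (xi : vector_field M)
    (eta : {scalar vector_field M}) (g : riemannian_metric M)
    (D Ds D0 : affine_connection M) :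
  almost_cosymplectic_statistical phi xi eta g D Ds ->
  levi_civita g D0 ->
  let A := shape_op D xi in
  let As := shape_op Ds xi in
  forall X Y : vector_field M,
    curvature D0 X Y xi *+ 4
    = curvature D X Y xi + curvature Ds X Y xi
      + cov_endo Ds A Y X - cov_endo Ds A X Y
      + cov_endo D As Y X - cov_endo D As X Y.
Proof.
move=> [_ stat] lc A As X Y; have [tD tDs _] := stat.
rewrite (curvature_mean _ _ _ (levi_civita_mean _ _ _ _ stat lc)).
by rewrite -!cov_endo_shape_op_alt// !addrA.
Qed.
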